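(* Let $k$ be an algebraically closed field, let $(H_i)_{i\in I}$ be a family (indexed by a set $I$) of cosemisimple Hopf algebras over $k$, and let $H=\coprod_{i\in I}H_i$ be their coproduct in the category of Hopf algebras. Then the canonical group homomorphisms $\mathcal C(H_i)\to\mathcal C(H)$ induced by the inclusions $H_i\le H$ make the universal grading group $\mathcal C(H)$ the coproduct, in the category of groups, of the groups $\mathcal C(H_i)$, $i\in I$.
   Context: Conventions: $k$ is an algebraically closed field. A Hopf algebra is cosemisimple if its category of (right, finite-dimensional) comodules is semisimple. The coproduct $H$ of cosemisimple Hopf algebras $H_i$ in the category of Hopf algebras (which is also their coproduct as algebras) is again cosemisimple, and the canonical maps $H_i\to H$ are injective. A Hopf algebra map $\pi:H\to K$ is central if $\pi(h_1)\otimes h_2=\pi(h_2)\otimes h_1$ in $K\otimes H$ for all $h\in H$ (Sweedler notation). The category of central arrows of a cosemisimple Hopf algebra $H$ has as objects the central maps $H\to k[\Gamma]$ with $\Gamma$ a group, and as morphisms the commutative triangles under $H$. It has an initial object $H\to k[\mathcal C(H)]$, called the center of $H$; the group $\mathcal C(H)$ is called the universal grading group. Equivalently, $\mathcal C(H)$ is the group generated by the set $\widehat H$ of isomorphism classes of simple $H$-comodules subject to the relations $x\cdot y=z$ whenever $z$ is a direct summand of $x\otimes y$. For an inclusion $H'\le H$ of cosemisimple Hopf algebras, the composition $H'\to H\to k[\mathcal C(H)]$ is central and hence factors through $k[\mathcal C(H')]\to k[\mathcal C(H)]$ for a unique group homomorphism $\mathcal C(H')\to\mathcal C(H)$; this is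 the canonical homomorphism induced by the inclusion. *)

(* Defs.v *)
From HB Require Import structures.
From mathcomp Require Import all_boot all_algebra.
From mathcomp Require Import finmap.
From mathcomp Require Import boolp.
From mathcomp Require Import monalg.

Set Implicit Arguments.
Unset Strict Implicit.
Unset Printing Implicit Defensive.

Import GRing.Theory.
Local Open Scope ring_scope.
Local Open Scope quotient_scope.

Section LinearExtension.
Variables (k : fieldType) (K : choiceType) (V : lmodType k).
Implicit Types (f : K -> V) (x y : {malg k[K]}).

Definition linext f x : V := \sum_(i <- msupp x) x@_i *: f i.

Lemma linextw f x (d : {fset K}) : (msupp x `<=` d)%fset ->
  linext f x = \sum_(i <- d) x@_i *: f i.
Proof.
move=> le_xd; apply: big_fset_incl => // i _ /mcoeff_outdom ->.
by rewrite scale0r.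
Qed.

Fact linext_is_linear f : linear (linext f).
Proof.
move=> a x y; pose d := (msupp x `|` msupp y)%fset.
have lex : (msupp x `<=` d)%fset by apply: fsubsetUl.
have ley : (msupp y `<=` d)%fset by apply: fsubsetUr.
have lexy : (msupp (a *: x + y) `<=` d)%fset.
  apply: fsubset_trans (msuppD_le _ _) _; apply: fsetSU; exact: msuppZ_le.
rewrite (linextw f lex) (linextw f ley) (linextw f lexy) scaler_sumr -big_split.
by apply: eq_bigr => i _ /=; rewrite mcoeffD mcoeffZ scalerDl scalerA.
Qed.
HB.instance Definition _ f :=
  GRing.isLinear.Build k {malg k[K]} V _ (linext f) (linext_is_linear f).

Lemma linextU f i : linext f << i >> = f i.
Proof.
by rewrite (linextw f (@msuppU_le _ _ i 1)) big_seq_fset1 mcoeffUU scale1r.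
Qed.

Lemma linext_linear_param (X : lmodType k) (f : X -> K -> V) x :
  (forall i, linear (f^~ i)) -> linear (fun t => linext (f t) x).
Proof.
move=> lf a t u; rewrite /linext scaler_sumr -big_split.
by apply: eq_bigr => i _; rewrite /= lf scalerDr !scalerA mulrC.
Qed.

Lemma malgE1 x : x = \sum_(i <- msupp x) x@_i *: << i >>.
Proof.
rewrite [LHS]monalgE; apply: eq_bigr => i _.
by apply/malgP => j; rewrite mcoeffZ !mcoeffU mulrnAr mulr1.
Qed.

Lemma malg_linear_ext (g h : {linear {malg k[K]} -> V}) :
  (forall i, g << i >> = h << i >>) -> g =1 h.
Proof.
move=> gh x; rewrite [x]malgE1 !linear_sum; apply: eq_bigr => i _.
by rewrite !linearZ /= gh.
Qed.

End LinearExtension.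

(* The tensor product of two vector spaces: the free module on pairs modulo
   the submodule generated by the bilinearity relations. *)
Section TensorDef.
Variables (k : fieldType) (V W : lmodType k).
Local Notation F := {malg k[(V * W)%type]}.

Inductive bilin_span : F -> Prop :=
| BilinDl v v' w : bilin_span (<< (v + v', w) >> - << (v, w) >> - << (v', w) >>)
| BilinDr v w w' : bilin_span (<< (v, w + w') >> - << (v, w) >> - << (v, w') >>)
| BilinZl a v w : bilin_span (<< (a *: v, w) >> - a *: << (v, w) >>)
| BilinZr a v w : bilin_span (<< (v, a *: w) >> - a *: << (v, w) >>)
| BilinLin0 : bilin_span 0
| BilinLin a x y : bilin_span x -> bilin_span y -> bilin_span (a *: x + y).

Definition bilin_pred : {pred F} := fun x => `[< bilin_span x >].

Fact bilin_pred_zmod_closed : zmod_closed bilin_pred.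
Proof.
split=> [|x y /asboolP xP /asboolP yP]; first by apply/asboolP/BilinLin0.
apply/asboolP; rewrite addrC -scaleN1r; exact: BilinLin.
Qed.
HB.instance Definition _ :=
  GRing.isZmodClosed.Build F bilin_pred bilin_pred_zmod_closed.

Definition tens : Type := Quotient.quot bilin_pred.
HB.instance Definition _ := GRing.Zmodule.on tens.
HB.instance Definition _ := EqQuotient.on tens.
HB.instance Definition _ := ZmodQuotient.on tens.

Lemma tens_eqP (x y : F) : \pi_tens x = \pi_tens y <-> bilin_span (x - y).
Proof.
split; first by move/eqP; rewrite eqquotE Quotient.equivE => /asboolP.
by move=> xy; apply/eqP; rewrite eqquotE Quotient.equivE; apply/asboolP.
Qed.

Definition tscale (a : k) (t : tens) : tens := \pi_tens (a *: repr t).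

Lemma tscale_pi a x : tscale a (\pi_tens x) = \pi_tens (a *: x).
Proof.
apply/tens_eqP; rewrite -scalerBr -[_ *: _]addr0.
by apply: BilinLin BilinLin0; apply/tens_eqP; rewrite reprK.
Qed.

Lemma tpiD x y : \pi_tens (x + y) = \pi_tens x + \pi_tens y.
Proof. by rewrite pi_addr. Qed.

Fact tscaleA a b t : tscale a (tscale b t) = tscale (a * b) t.
Proof. by elim/quotW: t => x; rewrite (tscale_pi b) !tscale_pi scalerA. Qed.
Fact tscale1 : left_id 1 tscale.
Proof. by elim/quotW=> x; rewrite tscale_pi scale1r. Qed.
Fact tscaleDr : right_distributive tscale +%R.
Proof.
by move=> a; elim/quotW=> x; elim/quotW=> y; rewrite -tpiD !tscale_pi -tpiD scalerDr.
Qed.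
Fact tscaleDl t : {morph tscale^~ t : a b / a + b}.
Proof. by move=> a b; elim/quotW: t => x; rewrite !tscale_pi -tpiD scalerDl. Qed.
HB.instance Definition _ :=
  GRing.Zmodule_isLmodule.Build k tens tscaleA tscale1 tscaleDr tscaleDl.

Definition tpure (v : V) (w : W) : tens := \pi_tens << (v, w) >>.

End TensorDef.

Arguments tpure {k V W}.
Notation "v ⊗ w" := (tpure v w) (at level 40, left associativity) : ring_scope.

Definition bilin (k : fieldType) (V W U : lmodType k) (B : V -> W -> U) :=
  (forall w, linear (B^~ w)) /\ (forall v, linear (B v)).

Section TensorTheory.
Variables (k : fieldType) (V W : lmodType k).

Lemma tpure_bilin : bilin (@tpure k V W).
Proof.
have tpureDl (v v' : V) (w : W) : (v + v') ⊗ w = v ⊗ w + v' ⊗ w.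
  by rewrite -tpiD; apply/tens_eqP; rewrite opprD addrA; apply: BilinDl.
have tpureDr (v : V) (w w' : W) : v ⊗ (w + w') = v ⊗ w + v ⊗ w'.
  by rewrite -tpiD; apply/tens_eqP; rewrite opprD addrA; apply: BilinDr.
split=> [w a v v'|v a w w'].
  rewrite tpureDl; congr (_ + _).
  by rewrite -[RHS]/(tscale a _) tscale_pi; apply/tens_eqP/BilinZl.
rewrite tpureDr; congr (_ + _).
by rewrite -[RHS]/(tscale a _) tscale_pi; apply/tens_eqP/BilinZr.
Qed.

HB.instance Definition _ (v : V) :=
  GRing.isLinear.Build k W (tens V W) _ (tpure v) (tpure_bilin.2 v).

Lemma tpureDl (v v' : V) (w : W) : (v + v') ⊗ w = v ⊗ w + v' ⊗ w.
Proof. by have := tpure_bilin.1 w 1 v v'; rewrite !scale1r. Qed.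
Lemma tpure0l (w : W) : (0 : V) ⊗ w = 0.
Proof. by apply: (addrI (0 ⊗ w)); rewrite -tpureDl !addr0. Qed.
Lemma tpureZl a (v : V) (w : W) : (a *: v) ⊗ w = a *: (v ⊗ w).
Proof. by have := tpure_bilin.1 w a v 0; rewrite tpure0l !addr0. Qed.
Lemma tpureDr (v : V) (w w' : W) : v ⊗ (w + w') = v ⊗ w + v ⊗ w'.
Proof. exact: linearD. Qed.
Lemma tpureZr a (v : V) (w : W) : v ⊗ (a *: w) = a *: (v ⊗ w).
Proof. exact: linearZ. Qed.

Fact tpi_is_linear : linear (\pi_(tens V W) : {malg k[(V * W)%type]} -> tens V W).
Proof. by move=> a x y; rewrite tpiD -[_ *: _ in RHS]/(tscale a _) tscale_pi. Qed.

Lemma tens_ind (P : tens V W -> Prop) :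
    (forall a t u, P t -> P u -> P (a *: t + u)) -> P 0 ->
    (forall v w, P (v ⊗ w)) -> forall t, P t.
Proof.
move=> Plin P0 Ppure; elim/quotW=> x; rewrite [x]malgE1.
elim: (enum_fset _) => [|[v w] s IHs].
  by rewrite big_nil pi_zeror.
by rewrite big_cons tpi_is_linear; apply: Plin => //; apply: Ppure.
Qed.

Lemma tens_linear_ext (U : lmodType k) (f g : {linear tens V W -> U}) :
  (forall v w, f (v ⊗ w) = g (v ⊗ w)) -> f =1 g.
Proof.
move=> fg; apply: tens_ind => // [a t u ft fu|]; last by rewrite !linear0.
by rewrite !linearP /= ft fu.
Qed.

(* Meaningful only for bilinear B. *)
Definition tlift (U : lmodType k) (B : V -> W -> U) (t : tens V W) : U :=
  linext (fun p => B p.1 p.2) (repr t).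

Section Lift.
Variables (U : lmodType k) (B : V -> W -> U).
Hypothesis bB : bilin B.

Lemma tlift_pi x : tlift B (\pi_(tens V W) x) = linext (fun p => B p.1 p.2) x.
Proof.
have Bl v v' w a : B (a *: v + v') w = a *: B v w + B v' w by exact: bB.1.
have Br v w w' a : B v (a *: w + w') = a *: B v w + B v w' by exact: bB.2.
have BDl v v' w : B (v + v') w = B v w + B v' w.
  by have := Bl v v' w 1; rewrite !scale1r.
have BDr v w w' : B v (w + w') = B v w + B v w'.
  by have := Br v w w' 1; rewrite !scale1r.
have B0l w : B 0 w = 0 by apply: (addrI (B 0 w)); rewrite -BDl !addr0.
have B0r v : B v 0 = 0 by apply: (addrI (B v 0)); rewrite -BDr !addr0.
apply/eqP; rewrite -subr_eq0 -linearB; apply/eqP.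
have /tens_eqP: \pi_(tens V W) (repr (\pi_(tens V W) x)) = \pi_(tens V W) x.
  by rewrite reprK.
elim=> {x} [v v' w|v w w'|a v w|a v w||a x y _ x0 _ y0].
- by rewrite !linearB /= !linextU /= BDl [B v w + _]addrC addrK subrr.
- by rewrite !linearB /= !linextU /= BDr [B v w + _]addrC addrK subrr.
- by rewrite linearB linearZ /= !linextU /= -[a *: v]addr0 Bl B0l addr0 subrr.
- by rewrite linearB linearZ /= !linextU /= -[a *: w]addr0 Br B0r addr0 subrr.
- exact: linear0.
- by rewrite linearP /= x0 y0 scaler0 addr0.
Qed.

Lemma tlift_pure v w : tlift B (v ⊗ w) = B v w.
Proof. by rewrite tlift_pi linextU. Qed.

Lemma tlift_linear : linear (tlift B).
Proof.
move=> a; elim/quotW=> x; elim/quotW=> y; rewrite -tpi_is_linear !tlift_pi.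
exact: linearP.
Qed.
End Lift.

Lemma tlift_linear_param (X U : lmodType k) (B : X -> V -> W -> U) t :
    (forall x, bilin (B x)) -> (forall v w, linear (fun x => B x v w)) ->
  linear (fun x => tlift (B x) t).
Proof.
move=> bB lB a x x'.
have tlift0 y : tlift (B y) 0 = 0.
  have := tlift_linear (bB y) (-1) 0 0.
  by rewrite scaler0 addr0 scaleN1r addNr.
elim/tens_ind: t => [b t u IHt IHu||v w].
- rewrite !(tlift_linear (bB _)) IHt IHu !scalerDr !scalerA.
  by rewrite [b * a]mulrC addrACA.
- by rewrite !tlift0 scaler0 addr0.
- by rewrite !(tlift_pure (bB _)) lB.
Qed.

End TensorTheory.

Section TensorMaps.
Variables (k : fieldType).
Implicit Types (U V W : lmodType k).

Section Map.
Variables (V W V' W' : lmodType k).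
Variables (f : {linear V -> V'}) (g : {linear W -> W'}).
Definition tmap : tens V W -> tens V' W' := tlift (fun v w => f v ⊗ g w).
Fact tmap_bilin : bilin (fun v w => f v ⊗ g w).
Proof.
split=> [w a v v'|v a w w']; first by rewrite (linearP f) tpureDl tpureZl.
by rewrite (linearP g) tpureDr tpureZr.
Qed.
HB.instance Definition _ :=
  GRing.isLinear.Build k (tens V W) (tens V' W') _ tmap (tlift_linear tmap_bilin).
Lemma tmapE v w : tmap (v ⊗ w) = f v ⊗ g w.
Proof. exact: tlift_pure tmap_bilin v w. Qed.
End Map.

Section Swap.
Variables (V W : lmodType k).
Definition tswap : tens V W -> tens W V := tlift (fun v w => w ⊗ v).
Fact tswap_bilin : bilin (fun (v : V) (w : W) => w ⊗ v).
Proof.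
by split=> ? ? ? ?; rewrite (tpureDl, tpureDr) (tpureZl, tpureZr).
Qed.
HB.instance Definition _ :=
  GRing.isLinear.Build k (tens V W) (tens W V) _ tswap (tlift_linear tswap_bilin).
Lemma tswapE v w : tswap (v ⊗ w) = w ⊗ v.
Proof. exact: tlift_pure tswap_bilin v w. Qed.
End Swap.

Section Assoc.
Variables (U V W : lmodType k).
Definition tassoc : tens (tens U V) W -> tens U (tens V W) :=
  tlift (fun t w => tlift (fun u v => u ⊗ (v ⊗ w)) t).
Fact tassoc_bilin_in (w : W) : bilin (fun (u : U) (v : V) => u ⊗ (v ⊗ w)).
Proof.
split=> [v a u u'|u a v v']; first by rewrite tpureDl tpureZl.
by rewrite tpureDl tpureZl tpureDr tpureZr.
Qed.
Fact tassoc_bilin :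
  bilin (fun (t : tens U V) (w : W) => tlift (fun u v => u ⊗ (v ⊗ w)) t).
Proof.
split=> [w|t]; first exact: tlift_linear (tassoc_bilin_in w).
apply: tlift_linear_param tassoc_bilin_in _ => u v a w w'.
by rewrite !tpureDr !tpureZr.
Qed.
HB.instance Definition _ := GRing.isLinear.Build k (tens (tens U V) W)
  (tens U (tens V W)) _ tassoc (tlift_linear tassoc_bilin).
Lemma tassocE u v w : tassoc ((u ⊗ v) ⊗ w) = u ⊗ (v ⊗ w).
Proof.
by rewrite /tassoc (tlift_pure tassoc_bilin) (tlift_pure (tassoc_bilin_in _)).
Qed.
End Assoc.

(* The unit isomorphisms of the tensor product. *)
Section Unitors.
Variables (V : lmodType k).
Definition tunitl : tens k^o V -> V := tlift (fun (a : k^o) (v : V) => a *: v).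
Fact tunitl_bilin : bilin (fun (a : k^o) (v : V) => a *: v).
Proof.
split=> [v a b c|a b v w] /=; first by rewrite scalerDl scalerA.
by rewrite scalerDr !scalerA mulrC.
Qed.
HB.instance Definition _ :=
  GRing.isLinear.Build k (tens k^o V) V _ tunitl (tlift_linear tunitl_bilin).
Lemma tunitlE (a : k^o) (v : V) : tunitl (a ⊗ v) = a *: v.
Proof. exact: tlift_pure tunitl_bilin a v. Qed.

Definition tunitr : tens V k^o -> V := tlift (fun (v : V) (a : k^o) => a *: v).
Fact tunitr_bilin : bilin (fun (v : V) (a : k^o) => a *: v).
Proof. by split=> [a|v]; [apply: tunitl_bilin.2|apply: tunitl_bilin.1]. Qed.
HB.instance Definition _ :=
  GRing.isLinear.Build k (tens V k^o) V _ tunitr (tlift_linear tunitr_bilin).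
Lemma tunitrE (v : V) (a : k^o) : tunitr (v ⊗ a) = a *: v.
Proof. exact: tlift_pure tunitr_bilin v a. Qed.
End Unitors.

Section Mul.
Variable (A : algType k).
Definition tmul : tens A A -> A := tlift *%R.
Fact tmul_bilin : bilin ( *%R : A -> A -> A).
Proof.
split=> [y a x x'|x a y y']; first by rewrite mulrDl scalerAl.
by rewrite mulrDr scalerAr.
Qed.
HB.instance Definition _ :=
  GRing.isLinear.Build k (tens A A) A _ tmul (tlift_linear tmul_bilin).
Lemma tmulE x y : tmul (x ⊗ y) = x * y.
Proof. exact: tlift_pure tmul_bilin x y. Qed.
End Mul.

(* The multiplication of the algebra A ⊗ B. *)
Section TensorAlgebra.
Variables (A B : algType k).
Definition tens_mul (s t : tens A B) : tens A B :=
  tlift (fun a b => tlift (fun a' b' => (a * a') ⊗ (b * b')) t) s.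
Fact tens_mul_bilin_in a b :
  bilin (fun (a' : A) (b' : B) => (a * a') ⊗ (b * b')).
Proof.
split=> [y c x x'|x c y y']; first by rewrite mulrDr -scalerAr tpureDl tpureZl.
by rewrite mulrDr -scalerAr tpureDr tpureZr.
Qed.
Fact tens_mul_bilin_out t :
  bilin (fun (a : A) (b : B) => tlift (fun a' b' => (a * a') ⊗ (b * b')) t).
Proof.
split=> [b|a].
  apply: tlift_linear_param (tens_mul_bilin_in^~ b) _ => x y c a a'.
  by rewrite mulrDl -scalerAl tpureDl tpureZl.
apply: tlift_linear_param (tens_mul_bilin_in a) _ => x y c b b'.
by rewrite mulrDl -scalerAl tpureDr tpureZr.
Qed.
Fact tens_mul_bilin : bilin tens_mul.
Proof.
split=> [t|s]; first exact: tlift_linear (tens_mul_bilin_out t).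
apply: tlift_linear_param tens_mul_bilin_out _ => a b.
exact: tlift_linear (tens_mul_bilin_in a b).
Qed.
Lemma tens_mulE a b a' b' : tens_mul (a ⊗ b) (a' ⊗ b') = (a * a') ⊗ (b * b').
Proof.
by rewrite /tens_mul (tlift_pure (tens_mul_bilin_out _))
  (tlift_pure (tens_mul_bilin_in _ _)).
Qed.
End TensorAlgebra.

End TensorMaps.

Arguments tswap {k V W}.
Arguments tassoc {k U V W}.
Arguments tunitl {k V}.
Arguments tunitr {k V}.
Arguments tmul {k A}.

HB.mixin Record Lmodule_isCoalgebra (k : fieldType) C of GRing.Lmodule k C := {
  comul : {linear C -> tens C C};
  counit : {linear C -> k^o};
  comulA : forall c,
    tassoc (tmap comul idfun (comul c)) = tmap idfun comul (comul c);
  counitl : forall c, tunitl (tmap counit idfun (comul c)) = c;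
  counitr : forall c, tunitr (tmap idfun counit (comul c)) = c
}.
#[short(type="coalgType")]
HB.structure Definition Coalgebra (k : fieldType) :=
  {C of GRing.Lmodule k C & Lmodule_isCoalgebra k C}.

HB.mixin Record Coalgebra_isHopf (k : fieldType) H
    of GRing.Algebra k H & Coalgebra k H := {
  comul1 : comul (1 : H) = 1 ⊗ 1;
  comulM : forall x y : H, comul (x * y) = tens_mul (comul x) (comul y);
  counit1 : counit (1 : H) = 1;
  counitM : forall x y : H, counit (x * y) = counit x * counit y;
  antipode : {linear H -> H};
  antipodel : forall x : H, tmul (tmap antipode idfun (comul x)) = counit x *: 1;
  antipoder : forall x : H, tmul (tmap idfun antipode (comul x)) = counit x *: 1
}.
#[short(type="hopfAlgType")]
HB.structure Definition HopfAlgebra (k : fieldType) :=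
  {H of GRing.Algebra k H & Coalgebra k H & Coalgebra_isHopf k H}.

(* Bialgebra maps between Hopf algebras automatically commute with the
   antipodes. *)
HB.mixin Record isCoalgMorphism (k : fieldType) (C D : coalgType k)
    (f : C -> D) of @GRing.Linear k C D *:%R f := {
  comul_morph : forall c, comul (f c) = tmap f f (comul c);
  counit_morph : forall c, counit (f c) = counit c
}.
HB.structure Definition HopfMorphism (k : fieldType) (H K : hopfAlgType k) :=
  {f of @GRing.LRMorphism k H K *:%R f & isCoalgMorphism k H K f}.
Notation "{ 'hopf' H -> K }" := (HopfMorphism.type H%type K%type)
  (H at level 98, K at level 99, format "{ 'hopf'  H  ->  K }") : type_scope.

(* monalg only equips {malg k[M]} with a product for conical monoids M, hence
   the separate ring structure on the alias below. *)
Definition galg (k : fieldType) (G : groupType) : Type := {malg k[G]}.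

Section GroupAlgebra.
Variables (k : fieldType) (G : groupType).
Local Notation kG := (galg k G).
HB.instance Definition _ := GRing.Lmodule.on kG.

Definition gof (a : G) : kG := << a >>.

Definition gmul (x y : kG) : kG :=
  linext (fun a => linext (fun b => gof (a * b)%g) y : kG) x.

Lemma gmulE a b : gmul (gof a) (gof b) = gof (a * b)%g.
Proof. by rewrite /gmul !linextU. Qed.

Lemma galg_ind (P : kG -> Prop) :
    (forall c x y, P x -> P y -> P (c *: x + y)) -> P 0 ->
    (forall a, P (gof a)) -> forall x, P x.
Proof.
move=> Plin P0 Pg x; rewrite [x]malgE1.
elim: (enum_fset _) => [|a s IHs]; first by rewrite big_nil.
by rewrite big_cons; apply: Plin => //; apply: Pg.
Qed.

Fact gmul_bilin : bilin gmul.
Proof.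
split=> [y|x]; first exact: linext_is_linear.
apply: linext_linear_param => a; exact: linext_is_linear.
Qed.

Let gmulPl c x x' y : gmul (c *: x + x') y = c *: gmul x y + gmul x' y.
Proof. exact: gmul_bilin.1. Qed.
Let gmulPr c x y y' : gmul x (c *: y + y') = c *: gmul x y + gmul x y'.
Proof. exact: gmul_bilin.2. Qed.
Let gmul0l y : gmul 0 y = 0.
Proof. by rewrite /gmul linear0. Qed.
Let gmul0r x : gmul x 0 = 0.
Proof. by have := gmulPr (-1) x 0 0; rewrite scaler0 addr0 scaleN1r addNr. Qed.

Fact gmulA : associative gmul.
Proof.
elim/galg_ind=> [c x x' IH IH'||a] y z; first by rewrite !gmulPl IH IH'.
  by rewrite !gmul0l.
elim/galg_ind: y => [c y y' IH IH'||b].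
- by rewrite gmulPl !gmulPr gmulPl IH IH'.
- by rewrite gmul0l !gmul0r gmul0l.
elim/galg_ind: z => [c z z' IH IH'||d]; first by rewrite !gmulPr IH IH'.
  by rewrite !gmul0r.
by rewrite !gmulE mulgA.
Qed.
Fact gmul1 : left_id (gof 1%g) gmul.
Proof.
elim/galg_ind=> [c x y IH IH'||a]; first by rewrite gmulPr IH IH'.
  exact: gmul0r.
by rewrite gmulE mul1g.
Qed.
Fact gmulr1 : right_id (gof 1%g) gmul.
Proof.
elim/galg_ind=> [c x y IH IH'||a]; first by rewrite gmulPl IH IH'.
  exact: gmul0l.
by rewrite gmulE mulg1.
Qed.
Fact gmulDl : left_distributive gmul +%R.
Proof. by move=> x y z; have := gmulPl 1 x y z; rewrite !scale1r. Qed.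
Fact gmulDr : right_distributive gmul +%R.
Proof. by move=> x y z; have := gmulPr 1 x y z; rewrite !scale1r. Qed.
Fact gof1_neq0 : gof 1%g != 0.
Proof. by rewrite monalgU_eq0 oner_eq0. Qed.
HB.instance Definition _ := GRing.Zmodule_isNzRing.Build kG
  gmulA gmul1 gmulr1 gmulDl gmulDr gof1_neq0.

Fact galg_scalerAl (c : k) (x y : kG) : c *: (x * y) = (c *: x) * y.
Proof. by have := gmulPl c x 0 y; rewrite gmul0l !addr0. Qed.
HB.instance Definition _ := GRing.Lmodule_isLalgebra.Build k kG galg_scalerAl.
Fact galg_scalerAr (c : k) (x y : kG) : c *: (x * y) = x * (c *: y).
Proof. by have := gmulPr c x y 0; rewrite gmul0r !addr0. Qed.
HB.instance Definition _ := GRing.Lalgebra_isAlgebra.Build k kG galg_scalerAr.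

Lemma gofM a b : gof (a * b)%g = gof a * gof b.
Proof. by rewrite -[RHS]/(gmul _ _) gmulE. Qed.

Lemma galg_linear_ext (V : lmodType k) (f g : {linear kG -> V}) :
  (forall a, f (gof a) = g (gof a)) -> f =1 g.
Proof.
move=> fg; apply: galg_ind => // [c x y fx fy|]; last by rewrite !linear0.
by rewrite !linearP /= fx fy.
Qed.

Definition gcomul : kG -> tens kG kG := linext (fun a => gof a ⊗ gof a).
HB.instance Definition _ := GRing.Linear.on gcomul.
Definition gcounit : kG -> k^o := linext (fun=> 1).
HB.instance Definition _ := GRing.Linear.on gcounit.
Definition gantipode : kG -> kG := linext (fun a => gof a^-1%g).
HB.instance Definition _ := GRing.Linear.on gantipode.

Lemma gcomulE a : gcomul (gof a) = gof a ⊗ gof a. Proof. exact: linextU. Qed.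
Lemma gcounitE a : gcounit (gof a) = 1. Proof. exact: linextU. Qed.
Lemma gantipodeE a : gantipode (gof a) = gof a^-1%g. Proof. exact: linextU. Qed.

Fact gcomulA x :
  tassoc (tmap gcomul idfun (gcomul x)) = tmap idfun gcomul (gcomul x).
Proof.
suff: (tassoc \o (tmap gcomul idfun \o gcomul)) =1 (tmap idfun gcomul \o gcomul) by apply.
apply: galg_linear_ext => a /=.
by rewrite gcomulE !tmapE /= gcomulE tassocE.
Qed.
Fact gcounitl x : tunitl (tmap gcounit idfun (gcomul x)) = x.
Proof.
suff: (tunitl \o (tmap gcounit idfun \o gcomul)) =1 (idfun) by apply.
apply: galg_linear_ext => a /=.
by rewrite gcomulE tmapE /= gcounitE tunitlE scale1r.
Qed.
Fact gcounitr x : tunitr (tmap idfun gcounit (gcomul x)) = x.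
Proof.
suff: (tunitr \o (tmap idfun gcounit \o gcomul)) =1 (idfun) by apply.
apply: galg_linear_ext => a /=.
by rewrite gcomulE tmapE /= gcounitE tunitrE scale1r.
Qed.
HB.instance Definition _ :=
  Lmodule_isCoalgebra.Build k kG gcomulA gcounitl gcounitr.

Fact gcomul1 : gcomul (1 : kG) = 1 ⊗ 1.
Proof. exact: gcomulE. Qed.
Fact gcomulM (x y : kG) : gcomul (x * y) = tens_mul (gcomul x) (gcomul y).
Proof.
have gl c u v : gcomul (c *: u + v) = c *: gcomul u + gcomul v.
  exact: linearP.
have tl c (s t u : tens kG kG) : tens_mul (c *: s + t) u = c *: tens_mul s u + tens_mul t u.
  exact: (@tens_mul_bilin k kG kG).1.
have tr c (s t u : tens kG kG) : tens_mul u (c *: s + t) = c *: tens_mul u s + tens_mul u t.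
  exact: (@tens_mul_bilin k kG kG).2.
have g0 : gcomul 0 = 0 by exact: linear0.
have t0r s : tens_mul s (0 : tens kG kG) = 0.
  by have := tr (-1) 0 0 s; rewrite scaler0 addr0 scaleN1r addNr.
have t0l s : tens_mul (0 : tens kG kG) s = 0.
  by have := tl (-1) 0 0 s; rewrite scaler0 addr0 scaleN1r addNr.
elim/galg_ind: x => [c x x' IH IH'||a].
- by rewrite mulrDl -scalerAl !gl IH IH' tl.
- by rewrite mul0r g0 t0l.
elim/galg_ind: y => [c y y' IH IH'||b].
- by rewrite mulrDr -scalerAr !gl IH IH' tr.
- by rewrite mulr0 g0 t0r.
by rewrite -gofM !gcomulE tens_mulE -gofM.
Qed.
Fact gcounit1 : gcounit (1 : kG) = 1.
Proof. exact: gcounitE. Qed.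
Fact gcounitM (x y : kG) : gcounit (x * y) = gcounit x * gcounit y.
Proof.
have gl c u v : gcounit (c *: u + v) = c * gcounit u + gcounit v.
  exact: linearP.
have g0 : gcounit 0 = 0 by exact: linear0.
elim/galg_ind: x => [c x x' IH IH'||a].
- by rewrite mulrDl -scalerAl !gl IH IH' mulrDl mulrA.
- by rewrite mul0r g0 mul0r.
elim/galg_ind: y => [c y y' IH IH'||b].
- by rewrite mulrDr -scalerAr !gl IH IH' mulrDr mulrCA.
- by rewrite mulr0 g0 mulr0.
by rewrite -gofM !gcounitE mulr1.
Qed.
Definition gunit (x : kG) : kG := gcounit x *: 1.
Fact gunit_linear : linear gunit.
Proof.
move=> c x y; rewrite /gunit scalerA -scalerDl; congr (_ *: _); exact: linearP.
Qed.
HB.instance Definition _ := 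
  GRing.isLinear.Build k kG kG _ gunit gunit_linear.
Fact gantipodel (x : kG) :
  tmul (tmap gantipode idfun (gcomul x)) = gcounit x *: 1.
Proof.
suff: (tmul \o (tmap gantipode idfun \o gcomul)) =1 gunit by apply.
apply: galg_linear_ext => a /=.
by rewrite /gunit gcomulE tmapE tmulE /= gantipodeE -gofM mulVg gcounitE scale1r.
Qed.
Fact gantipoder (x : kG) :
  tmul (tmap idfun gantipode (gcomul x)) = gcounit x *: 1.
Proof.
suff: (tmul \o (tmap idfun gantipode \o gcomul)) =1 gunit by apply.
apply: galg_linear_ext => a /=.
by rewrite /gunit gcomulE tmapE tmulE /= gantipodeE -gofM mulgV gcounitE scale1r.
Qed.
HB.instance Definition _ := Coalgebra_isHopf.Build k kG
  gcomul1 gcomulM gcounit1 gcounitM gantipodel gantipoder.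

End GroupAlgebra.

(* Right comodules of finite dimension. *)
Record comodule (k : fieldType) (C : coalgType k) := Comodule {
  comod_space :> vectType k;
  coact : {linear comod_space -> tens comod_space C};
  coactA : forall v,
    tassoc (tmap coact idfun (coact v)) = tmap idfun comul (coact v);
  coact1 : forall v, tunitr (tmap idfun counit (coact v)) = v
}.

Section Cosemisimple.
Variables (k : fieldType) (C : coalgType k).

Section Subcomodule.
Variable V : comodule C.

(* The coaction maps U into (the image of) U ⊗ C. *)
Definition subcomodule (U : {vspace V}) : Prop :=
  forall u, u \in U -> exists t : tens (subvs_of U) C,
    coact V u = tmap (vsval : {linear subvs_of U -> V}) idfun t.

Definition simple_subcomodule (U : {vspace V}) : Prop :=
  [/\ subcomodule U, U != 0%VS &
      forall U', subcomodule U' -> (U' <= U)%VS -> U' = 0%VS \/ U' = U].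

Definition semisimple_comodule : Prop :=
  exists n (U : 'I_n -> {vspace V}),
    [/\ forall i, simple_subcomodule (U i),
        (\sum_i U i)%VS = fullv & directv (\sum_i U i)].

End Subcomodule.

Definition cosemisimple : Prop := forall V : comodule C, semisimple_comodule V.

End Cosemisimple.

Section Center.
Variable k : fieldType.

Definition central (H K : hopfAlgType k) (p : {hopf H -> K}) : Prop :=
  forall h : H, tmap p idfun (comul h) = tmap p idfun (tswap (comul h)).

Record central_arrow (H : hopfAlgType k) := CentralArrow {
  ca_group : groupType;
  ca_map : {hopf H -> galg k ca_group};
  ca_central : central ca_map
}.

Definition ca_triangle (H : hopfAlgType k) (A B : central_arrow H)
    (f : {hopf galg k (ca_group A) -> galg k (ca_group B)}) : Prop :=
  forall h, f (ca_map A h) = ca_map B h.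

(* Z is an initial object of the category of central arrows of H, that is,
   Z is the center of H and [ca_group Z] its universal grading group. *)
Definition is_center (H : hopfAlgType k) (Z : central_arrow H) : Prop :=
  forall A : central_arrow H,
    exists2 f, ca_triangle (A := Z) (B := A) f &
      forall g, ca_triangle (A := Z) (B := A) g -> g =1 f.

Definition galg_map (G G' : groupType) (phi : {multiplicative G -> G'}) :
    galg k G -> galg k G' :=
  linext (fun a => gof k (phi a) : galg k G').
HB.instance Definition _ G G' phi := GRing.Linear.on (@galg_map G G' phi).

Lemma galg_mapE (G G' : groupType) (phi : {multiplicative G -> G'}) a :
  galg_map phi (gof k a) = gof k (phi a).
Proof. exact: linextU. Qed.

(* The square with sides f, the central arrows A and B, and k[phi] commutes;
   when A and B are centers, phi is the homomorphism induced by f. *)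
Definition induces (H K : hopfAlgType k) (f : {hopf H -> K})
    (A : central_arrow H) (B : central_arrow K)
    (phi : {multiplicative ca_group A -> ca_group B}) : Prop :=
  forall h, galg_map phi (ca_map A h) = ca_map B (f h).

Definition is_hopf_coproduct (I : Type) (H_ : I -> hopfAlgType k)
    (H : hopfAlgType k) (iota : forall i, {hopf H_ i -> H}) : Prop :=
  forall (K : hopfAlgType k) (f : forall i, {hopf H_ i -> K}),
    exists2 g : {hopf H -> K}, forall i, g \o iota i =1 f i &
      forall g' : {hopf H -> K}, (forall i, g' \o iota i =1 f i) -> g' =1 g.

End Center.

Definition is_group_coproduct (I : Type) (G_ : I -> groupType) (G : groupType)
    (iota : forall i, {multiplicative G_ i -> G}) : Prop :=
  forall (K : groupType) (f : forall i, {multiplicative G_ i -> K}),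
    exists2 g : {multiplicative G -> K}, forall i, g \o iota i =1 f i &
      forall g' : {multiplicative G -> K},
        (forall i, g' \o iota i =1 f i) -> g' =1 g.

(* Main.v *)
Require Import Defs.
From HB Require Import structures.
From mathcomp Require Import all_boot all_algebra.
From mathcomp Require Import boolp classical_sets monalg.

(* A universal grading group represents central maps to group algebras, so the
   theorem says that a central map out of a coproduct H is the same as a family
   of central maps out of the H_i.
   - Restriction to H_i preserves centrality because H_i -> H is split: the
     identity of H_i and the trivial maps (counit followed by unit) on the other
     factors induce a retraction H -> H_i.
   - For p : H -> k[K], the maps h |-> p(h_1) ⊗ h_2 and h |-> p(h_2) ⊗ h_1 are
     algebra maps, so p is central as soon as its restrictions to the H_i are,
     provided that the images of the H_i generate the algebra H. The subalgebra
     they generate is a Hopf subalgebra, so by the universal property its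
     inclusion into H has a section.
   Maps between group algebras come from group homomorphisms because the
   grouplike elements of k[G] are the elements of G. *)

Set Implicit Arguments.
Unset Strict Implicit.
Unset Printing Implicit Defensive.

Import GRing.Theory.
Local Open Scope ring_scope.

(** * Maps on tensor products *)

Section TensorMapTheory.
Variable k : fieldType.

Lemma tmap_ext (V W V' W' : lmodType k)
    (f f' : {linear V -> V'}) (g g' : {linear W -> W'}) :
  f =1 f' -> g =1 g' -> tmap f g =1 tmap f' g'.
Proof.
by move=> ff gg; apply: tens_linear_ext => v w; rewrite /= !tmapE ff gg.
Qed.

Lemma tmap_id (V W : lmodType k) (f : {linear V -> V}) (g : {linear W -> W}) :
  f =1 id -> g =1 id -> tmap f g =1 id.
Proof.
move=> f1 g1 t.
suff: tmap f g =1 (idfun : tens V W -> tens V W) by apply.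
by apply: tens_linear_ext => v w; rewrite /= tmapE f1 g1.
Qed.

Lemma tmap_comp (V W V' W' V'' W'' : lmodType k)
    (f : {linear V -> V'}) (g : {linear W -> W'})
    (f' : {linear V' -> V''}) (g' : {linear W' -> W''}) t :
  tmap f' g' (tmap f g t) = tmap (f' \o f) (g' \o g) t.
Proof.
suff: tmap f' g' \o tmap f g =1 tmap (f' \o f) (g' \o g) by apply.
by apply: tens_linear_ext => v w; rewrite /= !tmapE.
Qed.

Lemma tswap_tmap (V W V' W' : lmodType k)
    (f : {linear V -> V'}) (g : {linear W -> W'}) t :
  tswap (tmap f g t) = tmap g f (tswap t).
Proof.
suff: tswap \o tmap f g =1 tmap g f \o tswap by apply.
by apply: tens_linear_ext => v w; rewrite /= tmapE !tswapE tmapE.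
Qed.

(** Bundled linearity lets maps defined by a bilinear form be compared on pure tensors through
    [tens_linear_ext]. *)
Definition tlift_lin (V W U : lmodType k) (B : V -> W -> U) (bB : bilin B) :
    {linear tens V W -> U} :=
  HB.pack (tlift B) (GRing.isLinear.Build k _ _ _ (tlift B) (tlift_linear bB)).

Lemma tens3_linear_ext (U V W X : lmodType k)
    (f g : {linear tens (tens U V) W -> X}) :
  (forall u v w, f (u ⊗ v ⊗ w) = g (u ⊗ v ⊗ w)) -> f =1 g.
Proof.
move=> fg; apply: tens_linear_ext => t w.
elim/tens_ind: t => [a s t IHs IHt||u v].
- rewrite tpureDl tpureZl (linearP f) (linearP g).
  by congr (_ + _); [congr (_ *: _)|]; [exact: IHs|exact: IHt].
- by rewrite tpure0l (linear0 f) (linear0 g).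
- exact: fg.
Qed.

Lemma tassoc_tmap (U V W U' V' W' : lmodType k)
    (f : {linear U -> U'}) (g : {linear V -> V'}) (h : {linear W -> W'}) t :
  tassoc (tmap (tmap f g) h t) = tmap f (tmap g h) (tassoc t).
Proof.
suff: tassoc \o tmap (tmap f g) h =1 tmap f (tmap g h) \o tassoc by apply.
apply: tens3_linear_ext => u v w; transitivity (f u ⊗ (g v ⊗ h w)).
  by rewrite [LHS]/= (tmapE (tmap f g) h) /= (tmapE f g) tassocE.
by rewrite [RHS]/= tassocE (tmapE f) /= (tmapE g h).
Qed.

Section Algebra.
Variables A B : algType k.

Lemma tens_mulPl (s t u : tens A B) a :
  tens_mul (a *: s + t) u = a *: tens_mul s u + tens_mul t u.
Proof. exact: (@tens_mul_bilin k A B).1. Qed.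
Lemma tens_mulPr (s t u : tens A B) a :
  tens_mul u (a *: s + t) = a *: tens_mul u s + tens_mul u t.
Proof. exact: (@tens_mul_bilin k A B).2. Qed.
HB.instance Definition _ (s : tens A B) := GRing.isLinear.Build k
  (tens A B) (tens A B) _ (tens_mul s) ((@tens_mul_bilin k A B).2 s).
Lemma tens_mul0l (t : tens A B) : tens_mul 0 t = 0.
Proof.
by have := tens_mulPl 0 0 t (-1); rewrite scaler0 addr0 scaleN1r addNr.
Qed.
Lemma tens_mul0r (t : tens A B) : tens_mul t 0 = 0.
Proof.
by have := tens_mulPr 0 0 t (-1); rewrite scaler0 addr0 scaleN1r addNr.
Qed.

End Algebra.

Lemma tmapP (V W V' W' : lmodType k) (f : {linear V -> V'})
    (g : {linear W -> W'}) a s t :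
  tmap f g (a *: s + t) = a *: tmap f g s + tmap f g t.
Proof. exact: linearP. Qed.
Lemma tswapP (V W : lmodType k) a (s t : tens V W) :
  tswap (a *: s + t) = a *: tswap s + tswap t.
Proof. exact: linearP. Qed.

(** Both sides are bilinear in [s] and [t], so pure tensors suffice. *)
Lemma tens_morph_mul (A B A' B' : algType k)
    (F : {linear tens A B -> tens A' B'}) :
  (forall a b a' b', F (tens_mul (a ⊗ b) (a' ⊗ b')) =
     tens_mul (F (a ⊗ b)) (F (a' ⊗ b'))) ->
  forall s t, F (tens_mul s t) = tens_mul (F s) (F t).
Proof.
move=> FM s t; elim/tens_ind: s => [c s s' IHs IHs'||a b].
- transitivity (c *: F (tens_mul s t) + F (tens_mul s' t)).
    by rewrite tens_mulPl linearP.
  rewrite (linearP F) tens_mulPl.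
  exact: congr2 (congr1 _ IHs) IHs'.
- by rewrite tens_mul0l (linear0 F) tens_mul0l.
elim/tens_ind: t => [c t t' IHt IHt'||a' b'].
- transitivity (c *: F (tens_mul (a ⊗ b) t) + F (tens_mul (a ⊗ b) t')).
    by rewrite tens_mulPr linearP.
  transitivity (tens_mul (F (a ⊗ b)) (c *: F t + F t')).
    rewrite [RHS]tens_mulPr.
    exact: congr2 (congr1 _ IHt) IHt'.
  by congr tens_mul; rewrite linearP.
- by rewrite tens_mul0r (linear0 F) tens_mul0r.
exact: FM.
Qed.

Lemma tmapM (A B A' B' : algType k)
    (f : {lrmorphism A -> A'}) (g : {lrmorphism B -> B'}) s t :
  tmap f g (tens_mul s t) = tens_mul (tmap f g s) (tmap f g t).
Proof.
apply: tens_morph_mul => a b a' b' /=.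
by rewrite tens_mulE !tmapE tens_mulE !rmorphM.
Qed.

Lemma tswapM (A B : algType k) (s t : tens A B) :
  tswap (tens_mul s t) = tens_mul (tswap s) (tswap t).
Proof.
by apply: tens_morph_mul => a b a' b' /=; rewrite tens_mulE !tswapE tens_mulE.
Qed.

End TensorMapTheory.

(** * Hopf algebra morphisms *)

(** Writing c as e(c_1) c_2 turns e(c) into e(c_1) e(c_2), which is the scalar that T ⊗ T produces
    from [D c]. *)
Lemma trivial_comul (k : fieldType) (C : lmodType k) (B : algType k)
    (D : {linear C -> tens C C}) (e : {linear C -> k^o})
    (D' : {linear B -> tens B B}) (T : {linear C -> B}) :
    (forall c, tunitl (tmap e idfun (D c)) = c) -> D' 1 = 1 ⊗ 1 ->
    (forall c, T c = (e c : k) *: 1) ->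
  forall c, D' (T c) = tmap T T (D c).
Proof.
move=> el D'1 TE c; rewrite -{1}[c]el; move: (D c).
suff TT: (D' \o (T \o (tunitl \o tmap e idfun))) =1 tmap T T.
  by move=> t; apply: TT.
have eZ (a : k) y : e (a *: y) = a *: e y.
  exact: (linearZ_LR e a y).
apply: tens_linear_ext => x y.
transitivity ((e x * e y : k) *: (1 ⊗ 1 : tens B B)).
  rewrite [LHS]/= tmapE tunitlE /=.
  by rewrite TE eZ (linearZ_LR D') /= D'1.
by rewrite [RHS]/= tmapE !TE tpureZl tpureZr scalerA.
Qed.

Section HopfMorphisms.
Variable k : fieldType.
Implicit Types H K L : hopfAlgType k.

Section Identity.
Variable H : hopfAlgType k.
Fact idfun_comul (h : H) : comul (idfun h) = tmap idfun idfun (comul h).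
Proof. by rewrite tmap_id. Qed.
Fact idfun_counit (h : H) : counit (idfun h) = counit h.
Proof. by []. Qed.
HB.instance Definition _ :=
  isCoalgMorphism.Build k H H idfun idfun_comul idfun_counit.
End Identity.

Section Composition.
Variables (H K L : hopfAlgType k) (g : {hopf K -> L}) (f : {hopf H -> K}).
Fact comp_comul h : comul ((g \o f) h) = tmap (g \o f) (g \o f) (comul h).
Proof. by rewrite /= !comul_morph tmap_comp. Qed.
Fact comp_counit h : counit ((g \o f) h) = counit h.
Proof. by rewrite /= !counit_morph. Qed.
HB.instance Definition _ :=
  isCoalgMorphism.Build k H L (g \o f) comp_comul comp_counit.
End Composition.

Section Trivial.
Variables H K : hopfAlgType k.
Definition trivial_map (h : H) : K := (counit h : k) *: (1 : K).
Fact trivial_map_linear : linear trivial_map.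
Proof.
move=> a x y; rewrite /trivial_map (linearP counit).
by rewrite [LHS]scalerDl -scalerA.
Qed.
HB.instance Definition _ :=
  GRing.isLinear.Build k H K _ trivial_map trivial_map_linear.
Fact trivial_map_monoid : monoid_morphism trivial_map.
Proof.
split=> [|x y]; first by rewrite /trivial_map counit1 scale1r.
by rewrite /trivial_map counitM -scalerAl mul1r scalerA.
Qed.
HB.instance Definition _ :=
  GRing.isMonoidMorphism.Build H K trivial_map trivial_map_monoid.
Fact trivial_map_comul h :
  comul (trivial_map h) = tmap trivial_map trivial_map (comul h).
Proof. exact: (trivial_comul counitl comul1). Qed.
Fact trivial_map_counit h : counit (trivial_map h) = counit h.
Proof.
rewrite /trivial_map (linearZ_LR counit) /= counit1.
exact: mulr1.
Qed.
HB.instance Definition _ := isCoalgMorphism.Build k H K trivial_map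
  trivial_map_comul trivial_map_counit.
End Trivial.

End HopfMorphisms.

(** * Group algebras *)

Section GroupLike.
Variables (k : fieldType) (G : groupType).

Lemma gof_inj : injective (@gof k G).
Proof.
move=> a b /(congr1 (fun x : {malg k[G]} => x@_a)).
rewrite !mcoeffU eqxx; case: eqP => // _ /eqP.
by rewrite mulr1n mulr0n oner_eq0.
Qed.

Lemma comul_gof (a : G) :
  comul (gof k a : galg k G) =
    gof k a ⊗ gof k a :> tens (galg k G) (galg k G).
Proof. exact: gcomulE. Qed.

Lemma counit_gof (a : G) : counit (gof k a : galg k G) = 1 :> k^o.
Proof. exact: gcounitE. Qed.

(* Comparing the coefficients of [a ⊗ b] in [comul x = x ⊗ x] shows that the
   coefficients of x are orthogonal idempotents. *)
Lemma grouplike_gof (x : galg k G) :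
  comul x = x ⊗ x -> counit x = 1 -> exists a, x = gof k a.
Proof.
move=> xx x1.
pose X : {malg k[G]} := x.
pose B a b (u v : galg k G) : k^o :=
  (u : {malg k[G]})@_a * (v : {malg k[G]})@_b.
have bB a b : bilin (B a b).
  split=> [v c u u'|u c v v']; rewrite /B mcoeffD mcoeffZ.
    by rewrite mulrDl -mulrA.
  by rewrite mulrDr mulrCA.
have gP c (y z : galg k G) : gcomul (c *: y + z) = c *: gcomul y + gcomul z.
  exact: linearP.
(* Since [gcomul] is diagonal on the basis, its coefficient at a ⊗ b vanishes off the diagonal. *)
have key a b (y : galg k G) : tlift (B a b) (gcomul y) =
    if a == b then (y : {malg k[G]})@_a else 0.
  have BP c s t : tlift (B a b) (c *: s + t) =
      c *: tlift (B a b) s + tlift (B a b) t.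
    exact: tlift_linear (bB a b) c s t.
  elim/galg_ind: y => [c y z IHy IHz||d].
  - rewrite gP BP; etransitivity; first exact: congr2 (congr1 _ IHy) IHz.
    rewrite mcoeffD mcoeffZ.
    by case: ifP => // _; rewrite scaler0 addr0.
  - have -> : gcomul (0 : galg k G) = 0 by exact: linear0.
    have := BP (-1) 0 0; rewrite scaler0 addr0 scaleN1r addNr => ->.
    by rewrite mcoeff0 if_same.
  rewrite gcomulE (tlift_pure (bB a b)) /B !mcoeffU.
  case: (d =P a) => [->|_]; last by rewrite mul0r if_same.
  by case: eqP => _; rewrite ?mulr1 ?mulr0.
have gE a b : X@_a * X@_b = if a == b then X@_a else 0.
  by rewrite -key -[gcomul x]/(comul x) xx (tlift_pure (bB a b)).
(* The counit condition excludes x = 0. *)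
have [[a Xa]|X0] := pselect (exists a, X@_a != 0); last first.
  exfalso; suff X00 : x = 0.
    by move: x1 => /eqP; rewrite X00 linear0 eq_sym oner_eq0.
  apply/malgP => a; rewrite mcoeff0; apply/eqP/negP => /negP Xa.
  by apply: X0; exists a.
(* The nonzero idempotent at [a] is 1, and orthogonality to it kills every other coefficient. *)
exists a; apply/malgP => b; rewrite mcoeffU -/X.
have := gE a b; case: eqP => [<-|_] /eqP.
  by rewrite -{3}[X@_a]mulr1 (inj_eq (mulfI Xa)) => /eqP ->.
by rewrite mulf_eq0 (negPf Xa) => /eqP ->.
Qed.

End GroupLike.

Section GroupAlgebraMaps.
Variables (k : fieldType) (G G' : groupType).

Section Map.
Variable phi : {multiplicative G -> G'}.

(** The structure on [phi] only records compatibility with products; the unit follows by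
    cancellation. *)
Lemma multiplicative1 : phi 1%g = 1%g.
Proof. by apply: (mulIg (phi 1%g)); rewrite -gmulfM !mul1g. Qed.

Fact galg_map_monoid : monoid_morphism (galg_map phi : galg k G -> galg k G').
Proof.
split=> [|x y]; first by rewrite -[1]/(gof k 1%g) galg_mapE multiplicative1.
elim/galg_ind: x => [c x x' IH IH'||a].
- by rewrite mulrDl -scalerAl !linearP /= IH IH' mulrDl -scalerAl.
- by rewrite mul0r linear0 mul0r.
elim/galg_ind: y => [c y y' IH IH'||b].
- by rewrite mulrDr -scalerAr !linearP /= IH IH' mulrDr -scalerAr.
- by rewrite mulr0 linear0 mulr0.
by rewrite -gofM !galg_mapE gmulfM gofM.
Qed.
HB.instance Definition _ := GRing.isMonoidMorphism.Build
  (galg k G) (galg k G') (galg_map phi) galg_map_monoid.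

Fact galg_map_comul (x : galg k G) :
  comul (galg_map phi x) = tmap (galg_map phi) (galg_map phi) (comul x).
Proof.
suff: comul \o (galg_map phi) =1
  tmap (galg_map phi : galg k G -> galg k G') (galg_map phi) \o comul by apply.
apply: galg_linear_ext => a /=.
by rewrite galg_mapE !comul_gof tmapE /= galg_mapE.
Qed.
Fact galg_map_counit (x : galg k G) : counit (galg_map phi x) = counit x.
Proof.
suff: counit \o (galg_map phi : galg k G -> galg k G') =1 counit by apply.
apply: galg_linear_ext => a /=.
by rewrite galg_mapE !counit_gof.
Qed.
HB.instance Definition _ := isCoalgMorphism.Build k (galg k G) (galg k G')
  (galg_map phi) galg_map_comul galg_map_counit.
End Map.

Lemma galg_map_ext (phi psi : {multiplicative G -> G'}) :
  phi =1 psi -> galg_map phi =1 galg_map psi :> (galg k G -> galg k G').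
Proof. by move=> e; apply: galg_linear_ext => a /=; rewrite !galg_mapE e. Qed.

Lemma galg_map_inj (phi psi : {multiplicative G -> G'}) :
  galg_map phi =1 galg_map psi :> (galg k G -> galg k G') -> phi =1 psi.
Proof.
by move=> e a; apply: (@gof_inj k); rewrite -!galg_mapE e.
Qed.

(** A coalgebra map preserves grouplike elements, so [f] sends the basis G into the basis G';
    multiplicativity is read off through the injectivity of [gof]. *)
Lemma hopf_galg_map (f : {hopf galg k G -> galg k G'}) :
  exists phi : {multiplicative G -> G'}, f =1 galg_map phi.
Proof.
have /choice[phi phiE] a : exists b, f (gof k a) = gof k b.
  apply: grouplike_gof; first by rewrite comul_morph comul_gof tmapE.
  by rewrite counit_morph counit_gof.
have phiM : {morph phi : a b / (a * b)%g}.
  by move=> a b; apply: (@gof_inj k); rewrite gofM -!phiE gofM rmorphM.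
pose phi' : {multiplicative G -> G'} :=
  HB.pack phi (monoid.isMultiplicative.Build G G' phi phiM).
exists phi'; apply: galg_linear_ext => a.
exact: etrans (phiE a) (esym (galg_mapE k phi' a)).
Qed.

End GroupAlgebraMaps.

Lemma galg_map_comp (k : fieldType) (G1 G2 G3 : groupType)
    (psi : {multiplicative G2 -> G3}) (phi : {multiplicative G1 -> G2})
    (x : galg k G1) :
  galg_map (psi \o phi) x = galg_map psi (galg_map phi x).
Proof.
suff: galg_map (psi \o phi) =1
  galg_map psi \o galg_map phi :> (galg k G1 -> galg k G3) by apply.
by apply: galg_linear_ext => a /=; rewrite !galg_mapE.
Qed.

(* The preimage of a complement of the image of f, found with Zorn's lemma,
   is the kernel of the retraction. *)
Lemma linear_retraction (k : fieldType) (U V : lmodType k)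
    (f : {linear U -> V}) :
  injective f -> exists r : {linear V -> U}, cancel f r.
Proof.
move=> f_inj.
(* Zero need not belong to [W], so that the union of the empty chain qualifies; [W0] below adds
   it. *)
pose P (W : set V) := (forall a x y, W x -> W y -> W (a *: x + y)) /\
  (forall u, W (f u) -> u = 0).
have [|W [[Wlin Wf] Wmax]] := @Zorn_bigcup V P.
  move=> F FP Ftot; split=> [a x y [X FX Xx] [Y FY Yy]|u [X FX Xfu]];
    last first.
    exact: (FP X FX).2 Xfu.
  have [XY|YX] := Ftot X Y FX FY.
    by exists Y => //; apply: (FP Y FY).1 => //; exact: XY.
  by exists X => //; apply: (FP X FX).1 => //; exact: YX.
pose W0 (w : V) := W w \/ w = 0.
have W0lin a x y : W0 x -> W0 y -> W0 (a *: x + y).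
  move=> [Wx|->] [Wy|->].
  - by left; apply: Wlin.
  - left; have -> : a *: x + 0 = (a - 1) *: x + x.
      by rewrite addr0 scalerBl scale1r subrK.
    exact: Wlin.
  - by rewrite scaler0 add0r; left.
  - by rewrite scaler0 add0r; right.
have W00 : W0 0 by right.
have W0Z a x : W0 x -> W0 (a *: x).
  by move=> Wx; rewrite -[_ *: _]addr0; apply: W0lin.
have W0f u : W0 (f u) -> u = 0.
  by case=> [/Wf//|fu0]; apply: f_inj; rewrite fu0 linear0.
(* [W0] and the image of [f] span V: otherwise adjoining the line of [v] to [W0] contradicts
   maximality. *)
have dec v : exists u, W0 (v - f u).
  apply: contrapT => /forallNP nv.
  pose B : set V := fun x => exists c w, W0 w /\ x = c *: v + w.
  apply: (Wmax B); first split.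
  - by move=> w Ww; exists 0, w; rewrite scale0r add0r; split=> //; left.
  - move=> BW; apply: (nv 0); rewrite linear0 subr0; left; apply: BW.
    by exists 1, 0; rewrite scale1r addr0; split=> //; right.
  - split=> [a _ _ [c [w [Ww ->]]] [d [x [Wx ->]]]|u [c [w [Ww fu]]]].
      exists (a * c + d), (a *: w + x); split; first exact: W0lin.
      by rewrite scalerDr scalerDl scalerA addrACA.
    have [c0|c0] := eqVneq c 0.
      by apply: W0f; rewrite fu c0 scale0r add0r.
    (* From f u = c v + w with c nonzero, v - f(c^-1 u) = - c^-1 w lies in [W0]. *)
    case: (nv (c^-1 *: u)); rewrite linearZ /= fu scalerDr scalerA mulVf //.
    by rewrite scale1r opprD addrA subrr add0r -scaleNr; apply: W0Z.
have [r rP] := choice dec.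
(* [W0] meets the image of [f] trivially, so the decomposition is unique; linearity of [r] and the
   retraction property both follow. *)
have r_uniq v u : W0 (v - f u) -> r v = u.
  move=> Wu; apply/eqP; rewrite -subr_eq0; apply/eqP/W0f.
  rewrite linearB /=; have := W0lin (-1) _ _ (rP v) Wu.
  by rewrite scaleN1r opprB addrA subrK.
have r_lin : linear r.
  move=> a x y; apply: r_uniq; rewrite linearP /= opprD addrACA -scalerBr.
  exact: W0lin.
pose r' : {linear V -> U} := HB.pack r (GRing.isLinear.Build k V U _ r r_lin).
by exists r' => u; apply: r_uniq; rewrite subrr.
Qed.

(** * Antipodes *)

Section Convolution.
Variables (k : fieldType) (C : lmodType k) (A : algType k).
Variables (D : {linear C -> tens C C}) (e : {linear C -> k^o}).
Hypothesis DA : forall c, tassoc (tmap D idfun (D c)) = tmap idfun D (D c).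
Hypothesis Del : forall c, tunitl (tmap e idfun (D c)) = c.
Implicit Types f g h : {linear C -> A}.

(** The convolution product c |-> f(c_1) g(c_2). The coalgebra structure is given by bare maps, so
    that [sub_comul] can be used before its coalgebra is built. *)
Definition conv f g : C -> A := tmul \o (tmap f g \o D).
HB.instance Definition _ f g := GRing.Linear.on (conv f g).

Definition conv_inverse f g := forall c, conv f g c = (e c : k) *: 1.

Lemma conv_ext f f' g g' : f =1 f' -> g =1 g' -> conv f g =1 conv f' g'.
Proof. by move=> ff gg c; exact: congr1 (tmap_ext ff gg (D c)). Qed.

(** Both sides are f(c_1) g(c_2) h(c_3): [Psi] and [Phi] multiply the two bracketings of a triple
    tensor, and [tassoc] exchanges them. *)
Lemma convA f g h : conv (conv f g) h =1 conv f (conv g h).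
Proof.
move=> c.
pose Phi : {linear _ -> A} := tmul \o tmap f (tmul \o tmap g h).
pose Psi : {linear _ -> A} := tmul \o tmap (tmul \o tmap f g) h.
have PhiPsi : Psi =1 Phi \o tassoc.
  apply: tens3_linear_ext => x y z; transitivity (f x * g y * h z).
    by rewrite [LHS]/= (tmapE (tmul \o tmap f g) h) tmulE /= tmapE tmulE.
  by rewrite [RHS]/= tassocE (tmapE f) tmulE /= tmapE tmulE mulrA.
transitivity (Psi (tmap D idfun (D c))).
  exact: congr1 _ (esym (tmap_comp D idfun (tmul \o tmap f g) h (D c))).
rewrite PhiPsi [LHS]/= DA.
exact: congr1 _ (tmap_comp idfun D f (tmul \o tmap g h) (D c)).
Qed.

Lemma conv_unitl f g : (forall c, f c = (e c : k) *: 1) -> conv f g =1 g.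
Proof.
move=> fe c; rewrite -[in RHS](Del c).
suff : tmul \o tmap f g =1 g \o (tunitl \o tmap e idfun) by apply.
apply: tens_linear_ext => x y.
rewrite [LHS]/= tmapE tmulE fe [RHS]/= tmapE tunitlE /= (linearZ_LR g).
by rewrite -scalerAl mul1r.
Qed.

(** A left convolution inverse cancels: h is the convolution of f with that of g and h. *)
Lemma conv_cancel f g h h' :
  conv_inverse f g -> conv g h =1 conv g h' -> h =1 h'.
Proof.
move=> fg ghh' c; rewrite -(conv_unitl h fg) -(conv_unitl h' fg).
by rewrite !convA; exact: conv_ext.
Qed.

End Convolution.

Section Antipode.
Variables (k : fieldType) (A : algType k).
Variables (D : {linear A -> tens A A}) (e : {linear A -> k^o}).
Variable S : {linear A -> A}.
Hypothesis DA : forall c, tassoc (tmap D idfun (D c)) = tmap idfun D (D c).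
Hypothesis Del : forall c, tunitl (tmap e idfun (D c)) = c.
Hypothesis DM : forall x y, D (x * y) = tens_mul (D x) (D y).
Hypothesis eM : forall x y, e (x * y) = (e x : k) * e y.
Hypothesis Sl : conv_inverse D e S idfun.
Hypothesis Sr : conv_inverse D e idfun S.

(* Working in one variable at a time avoids the coalgebra A ⊗ A: cancelling in x
   gives [y_1 S(x y_2) = e(y) S(x)] (step1), then cancelling in y concludes. *)
Lemma antipodeM x y : S (x * y) = S y * S x.
Proof.
have bB z : bilin (fun a b => a * S (z * b)).
  split=> [b c u v|a c u v]; first by rewrite mulrDl scalerAl.
  by rewrite mulrDr -scalerAr linearP mulrDr scalerAr.
have Blin a b : linear (fun z => a * S (z * b)).
  by move=> c u v; rewrite mulrDl -scalerAl linearP mulrDr scalerAr.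
have step1 z y' : tlift (fun a b => a * S (z * b)) (D y') = (e y' : k) *: S z.
  pose G v := tlift (fun a b => a * S (v * b)) (D y').
  have Glin : linear G by apply: tlift_linear_param.
  pose G' : {linear A -> A} := HB.pack G (GRing.isLinear.Build k A A _ G Glin).
  (* [S] is left inverse to the identity, so it suffices to convolve both maps with the identity on
     the left. For [G'], the antipode axiom at c y' gives e(c) e(y'). *)
  apply: (conv_cancel DA Del Sl (h := G') (h' := (e y' : k) \*: S)) => c.
  transitivity (((e c : k) * (e y' : k)) *: (1 : A)).
    rewrite -eM -Sr /conv /= DM; move: (D c) => t; apply: esym.
    suff: tmul \o (tmap idfun S \o tlift_lin (@tens_mul_bilin_out k A A (D y')))
       =1 tmul \o tmap idfun G' by apply.
    apply: tens_linear_ext => a b.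
    rewrite [RHS]/= tmapE tmulE.
    transitivity (tmul (tmap idfun S (tens_mul (a ⊗ b) (D y')))); first by [].
    rewrite /G' /= /G; move: (D y') => u.
    suff: tmul \o (tmap idfun S \o tens_mul (a ⊗ b))
        =1 a \*o tlift_lin (bB b).
      by apply.
    apply: tens_linear_ext => a' b' /=.
    by rewrite tens_mulE tmapE tmulE /= (tlift_pure (bB b)) mulrA.
  apply: esym; rewrite mulrC -scalerA -Sr; move: (e y' : k) (D c) => r t.
  suff: tmul \o tmap idfun (r \*: S) =1 r \*: (tmul \o tmap idfun S) by apply.
  by apply: tens_linear_ext => a b /=; rewrite !tmapE !tmulE /= scalerAr.
pose F : {linear A -> A} := S \o (x \*o idfun).
pose F' : {linear A -> A} := S x \o* S.
(* After convolution with the identity both maps give e(c) S(x), the first by [step1], the second by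
   the antipode axiom at [c]. *)
apply: (conv_cancel DA Del Sl (h := F) (h' := F')) => c.
transitivity ((e c : k) *: S x).
  rewrite -step1 /conv /=; move: (D c) => t.
  suff: tmul \o tmap idfun F =1 tlift_lin (bB x) by apply.
  apply: tens_linear_ext => a b /=.
  by rewrite tmapE tmulE /F /= (tlift_pure (bB x)).
rewrite -[S x in LHS]mul1r scalerAl -Sr /conv /=.
move: (D c) => t.
suff: S x \o* (tmul \o tmap idfun S) =1 tmul \o tmap idfun F' by apply.
by apply: tens_linear_ext => a b /=; rewrite !tmapE !tmulE /F' /= mulrA.
Qed.

End Antipode.

(* Both sides are convolution inverse to f. *)
Lemma antipode_morph (k : fieldType) (A B : algType k)
    (D : {linear A -> tens A A}) (e : {linear A -> k^o}) (S : {linear A -> A})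
    (D' : {linear B -> tens B B}) (e' : {linear B -> k^o})
    (S' : {linear B -> B}) (f : {lrmorphism A -> B}) :
    (forall c, tassoc (tmap D idfun (D c)) = tmap idfun D (D c)) ->
    (forall c, tunitl (tmap e idfun (D c)) = c) ->
    conv_inverse D e idfun S -> conv_inverse D' e' S' idfun ->
    conv_inverse D' e' idfun S' ->
    (forall c, D' (f c) = tmap f f (D c)) -> (forall c, e' (f c) = e c) ->
  forall x, S' (f x) = f (S x).
Proof.
move=> DA Del Sr Sl' Sr' fD fe.
pose F : {linear A -> B} := S' \o f; pose F' : {linear A -> B} := f \o S.
pose f1 : {linear A -> B} := f.
have Ff : conv_inverse D e F f1.
  move=> c; rewrite -fe -Sl' /conv /= fD.
  exact: congr1 _ (esym (tmap_comp f f S' idfun (D c))).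
suff: F =1 F' by apply.
apply: (conv_cancel DA Del Ff) => c; transitivity ((e c : k) *: (1 : B)).
  rewrite -fe -Sr' /conv /= fD.
  exact: congr1 _ (esym (tmap_comp f f idfun S' (D c))).
have -> : (e c : k) *: (1 : B) = f ((e c : k) *: 1) by rewrite linearZ rmorph1.
rewrite -Sr /conv /=; move: (D c) => t.
suff: f \o (tmul \o tmap idfun S) =1 tmul \o tmap f1 F' by apply.
apply: tens_linear_ext => x y /=.
by rewrite !tmapE !tmulE /= rmorphM.
Qed.

(** * Hopf subalgebras *)

Section SubHopf.
Variables (k : fieldType) (A U : algType k).
Variables (D : {linear A -> tens A A}) (e : {linear A -> k^o}).
Variable S : {linear A -> A}.
Variables (inc : {lrmorphism U -> A}) (r : {linear A -> U}).
Hypothesis incK : cancel inc r.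
Hypothesis incD : forall u, exists t, D (inc u) = tmap inc inc t.
Hypothesis incS : forall u, exists v, S (inc u) = inc v.

(** The value is the unique preimage of [D (inc u)] under [tmap inc inc], so the choice of the
    retraction does not matter. *)
Definition sub_comul : {linear U -> tens U U} := tmap r r \o (D \o inc).
Definition sub_counit : {linear U -> k^o} := e \o inc.
Definition sub_antipode : {linear U -> U} := r \o (S \o inc).

Lemma sub_comulE u : tmap inc inc (sub_comul u) = D (inc u).
Proof.
rewrite /=; have [t ->] := incD u; congr tmap.
by rewrite tmap_comp tmap_id.
Qed.

Lemma sub_antipodeE u : inc (sub_antipode u) = S (inc u).
Proof. by rewrite /=; have [v ->] := incS u; rewrite incK. Qed.

(** A tensor power of a split injection is split. The Hopf axioms on U can thus be checked after
    mapping to A or its tensor powers. *)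
Lemma tmap_inc_inj : injective (tmap inc inc).
Proof.
apply: (can_inj (g := tmap r r)) => t; rewrite tmap_comp.
exact: tmap_id.
Qed.

Lemma tmap3_inc_inj : injective (tmap inc (tmap inc inc)).
Proof.
apply: (can_inj (g := tmap r (tmap r r))) => t; rewrite tmap_comp.
by apply: tmap_id => // s; rewrite /= tmap_comp; apply: tmap_id.
Qed.

Lemma sub_comulA :
  (forall c, tassoc (tmap D idfun (D c)) = tmap idfun D (D c)) ->
  forall u, tassoc (tmap sub_comul idfun (sub_comul u)) =
    tmap idfun sub_comul (sub_comul u).
Proof.
move=> DA u; apply: tmap3_inc_inj.
rewrite -tassoc_tmap (tmap_comp sub_comul idfun (tmap inc inc) inc).
rewrite (tmap_comp idfun sub_comul inc (tmap inc inc)).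
transitivity (tassoc (tmap (D \o inc) inc (sub_comul u))).
  have E := (tmap_ext (f := tmap inc inc \o sub_comul) (f' := D \o inc)
    (g := inc \o idfun) (g' := inc) sub_comulE (fun=> erefl) (sub_comul u)).
  exact (congr1 _ E).
transitivity (tassoc (tmap D idfun (tmap inc inc (sub_comul u)))).
  by rewrite (tmap_comp inc inc D idfun).
rewrite sub_comulE DA -sub_comulE (tmap_comp inc inc idfun D).
exact: (tmap_ext (f := idfun \o inc) (f' := inc \o idfun)
  (g := D \o inc) (g' := tmap inc inc \o sub_comul)
  (fun=> erefl) (fun x => esym (sub_comulE x)) (sub_comul u)).
Qed.

Lemma sub_counitl : (forall c, tunitl (tmap e idfun (D c)) = c) ->
  forall u, tunitl (tmap sub_counit idfun (sub_comul u)) = u.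
Proof.
move=> el u; apply: (can_inj incK); rewrite -[RHS]el -sub_comulE.
move: (sub_comul u) => t.
suff: inc \o (tunitl \o tmap sub_counit idfun) =1
   tunitl \o (tmap e idfun \o tmap inc inc) by apply.
apply: tens_linear_ext => x y /=.
by rewrite !tmapE !tunitlE /= linearZ.
Qed.

Lemma sub_counitr : (forall c, tunitr (tmap idfun e (D c)) = c) ->
  forall u, tunitr (tmap idfun sub_counit (sub_comul u)) = u.
Proof.
move=> er u; apply: (can_inj incK); rewrite -[RHS]er -sub_comulE.
move: (sub_comul u) => t.
suff: inc \o (tunitr \o tmap idfun sub_counit) =1
   tunitr \o (tmap idfun e \o tmap inc inc) by apply.
apply: tens_linear_ext => x y /=.
by rewrite !tmapE !tunitrE /= linearZ.
Qed.

Lemma sub_comul1 : D 1 = 1 ⊗ 1 -> sub_comul 1 = 1 ⊗ 1.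
Proof.
move=> D1; apply: tmap_inc_inj; have inc1 : inc 1 = 1 by exact: rmorph1.
by rewrite sub_comulE inc1 D1 tmapE /= inc1.
Qed.

Lemma sub_comulM : (forall x y, D (x * y) = tens_mul (D x) (D y)) ->
  forall x y, sub_comul (x * y) = tens_mul (sub_comul x) (sub_comul y).
Proof.
move=> DM x y; apply: tmap_inc_inj.
transitivity (tens_mul (D (inc x)) (D (inc y))).
  by rewrite sub_comulE (rmorphM inc) DM.
apply: esym; apply: (etrans (tmapM inc inc (sub_comul x) (sub_comul y))).
exact (congr2 _ (sub_comulE x) (sub_comulE y)).
Qed.

Lemma sub_antipodel : conv_inverse D e S idfun ->
  conv_inverse sub_comul sub_counit sub_antipode idfun.
Proof.
move=> Sl u; apply: (can_inj incK).
transitivity ((e (inc u) : k) *: (1 : A)); last by rewrite linearZ rmorph1.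
rewrite -Sl.
transitivity (tmul (tmap S idfun (tmap inc inc (sub_comul u)))); last first.
  by rewrite sub_comulE.
transitivity (inc (tmul (tmap sub_antipode idfun (sub_comul u)))); first by [].
move: (sub_comul u) => t.
suff: inc \o (tmul \o tmap sub_antipode idfun) =1
   tmul \o (tmap S idfun \o tmap inc inc) by apply.
apply: tens_linear_ext => x y /=.
rewrite !tmapE !tmulE rmorphM.
exact (congr2 *%R (sub_antipodeE x) erefl).
Qed.

Lemma sub_antipoder : conv_inverse D e idfun S ->
  conv_inverse sub_comul sub_counit idfun sub_antipode.
Proof.
move=> Sr u; apply: (can_inj incK).
transitivity ((e (inc u) : k) *: (1 : A)); last by rewrite linearZ rmorph1.
rewrite -Sr.
transitivity (tmul (tmap idfun S (tmap inc inc (sub_comul u)))); last first.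
  by rewrite sub_comulE.
transitivity (inc (tmul (tmap idfun sub_antipode (sub_comul u)))); first by [].
move: (sub_comul u) => t.
suff: inc \o (tmul \o tmap idfun sub_antipode) =1
   tmul \o (tmap idfun S \o tmap inc inc) by apply.
apply: tens_linear_ext => x y /=.
rewrite !tmapE !tmulE rmorphM.
exact (congr2 *%R erefl (sub_antipodeE y)).
Qed.

End SubHopf.

Lemma hopf_of_lrmorphism (k : fieldType) (H K : hopfAlgType k)
    (f : {lrmorphism H -> K}) :
    (forall h, comul (f h) = tmap f f (comul h)) ->
    (forall h, counit (f h) = counit h) ->
  exists g : {hopf H -> K}, g =1 f.
Proof.
move=> fD fe.
pose g : {hopf H -> K} := HB.pack (GRing.LRMorphism.sort f)
  (isCoalgMorphism.Build k H K f fD fe).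
by exists g.
Qed.

(** K is U with the structure restricted along a linear retraction of [inc]; afterwards only its
    image in H matters. *)
Lemma subalgebra_hopf (k : fieldType) (H : hopfAlgType k) (U : algType k)
    (inc : {lrmorphism U -> H}) :
    injective inc ->
    (forall u, exists t, comul (inc u) = tmap inc inc t) ->
    (forall u, exists v, antipode (inc u) = inc v) ->
  exists (K : hopfAlgType k) (j : {hopf K -> H}),
    injective j /\ (forall x, (exists y, j y = x) <-> exists u, inc u = x).
Proof.
move=> inc_inj incD incS; have [r incK] := linear_retraction inc_inj.
pose D := sub_comul comul inc r.
pose e := sub_counit counit inc.
pose S := sub_antipode antipode inc r.
have DA := sub_comulA incK incD comulA.
have el := sub_counitl incK incD counitl.
have er := sub_counitr incK incD counitr.
pose mC := Lmodule_isCoalgebra.Build k U DA el er.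
pose C : coalgType k := HB.pack U mC.
have D1 := sub_comul1 incK incD comul1.
have DM := sub_comulM incK incD comulM.
have e1 : e 1 = 1 by rewrite /e /= rmorph1; exact: counit1.
have eM x y : e (x * y) = e x * e y.
  by rewrite /e /= rmorphM; exact: counitM.
have Sl := sub_antipodel incK incD incS antipodel.
have Sr := sub_antipoder incK incD incS antipoder.
pose mH := Coalgebra_isHopf.Build k C D1 DM e1 eM Sl Sr.
pose K : hopfAlgType k := HB.pack U mC mH.
have jD (x : K) : comul (inc x) = tmap inc inc (comul x).
  exact: esym (sub_comulE incK incD x).
have je (x : K) : counit (inc x) = counit x by [].
have [j jE] := hopf_of_lrmorphism (f := inc : {lrmorphism K -> H}) jD je.
exists K, j; split; first by move=> x y; rewrite !jE; exact: inc_inj.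
by move=> x; split=> -[u <-]; exists u; rewrite jE.
Qed.

(** * Generated subalgebras *)

Section GeneratedSubalgebra.
Variables (k : fieldType) (A : algType k) (G : A -> Prop).

(** The inductive form allows claims on comultiplication, antipode and centrality to be proved by
    induction on how an element is generated. *)
Inductive generated : A -> Prop :=
| GenIn x : G x -> generated x
| Gen1 : generated 1
| GenM x y : generated x -> generated y -> generated (x * y)
| GenLin a x y : generated x -> generated y -> generated (a *: x + y).

Definition generated_pred : {pred A} := fun x => `[< generated x >].

Fact generated_subsemialg : GRing.subsemialg_closed generated_pred.
Proof.
have gen0 : generated 0.
  by have := GenLin (-1) Gen1 Gen1; rewrite scaleN1r addNr.
split=> [|||x y /asboolP gx /asboolP gy]; first exact/asboolP/Gen1.
- split=> [|x y /asboolP gx /asboolP gy]; first exact/asboolP.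
  by apply/asboolP; rewrite -[x]scale1r; exact: GenLin.
- move=> a x /asboolP gx; apply/asboolP; rewrite -[_ *: _]addr0.
  exact: GenLin.
- exact/asboolP/GenM.
Qed.
HB.instance Definition _ :=
  GRing.isSubalgClosed.Build k A generated_pred generated_subsemialg.

Record generated_sub := GeneratedSub {
  generated_val : A;
  _ : generated_val \in generated_pred
}.
HB.instance Definition _ := [isSub for generated_val].
HB.instance Definition _ := [Choice of generated_sub by <:].
HB.instance Definition _ := [SubChoice_isSubAlgebra of generated_sub by <:].

Definition generated_alg : algType k := generated_sub.
Fact generated_val_linear : linear (generated_val : generated_alg -> A).
Proof. exact: (linearP (val : generated_sub -> A)). Qed.
HB.instance Definition _ := GRing.isLinear.Build k generated_alg A _
  generated_val generated_val_linear.
Fact generated_val_monoid :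
  monoid_morphism (generated_val : generated_alg -> A).
Proof. by split=> [|x y]; [exact: (rmorph1 val)|exact: (rmorphM val)]. Qed.
HB.instance Definition _ := GRing.isMonoidMorphism.Build generated_alg A
  generated_val generated_val_monoid.
Definition generated_inc : {lrmorphism generated_alg -> A} := generated_val.

Lemma generated_inc_inj : injective generated_inc.
Proof. exact: val_inj. Qed.

Lemma generated_incP x : generated x <-> exists u, generated_inc u = x.
Proof.
split=> [gx|[[y /= gy] <-]]; last exact/asboolP.
by exists (GeneratedSub (introT (asboolP _) gx)).
Qed.

End GeneratedSubalgebra.

(** Preimages under [j] are unique, so [g] inherits all identities from [f]; for the
    comultiplication they are compared through j ⊗ j, injective because [j] splits linearly. *)
Lemma hopf_lift (k : fieldType) (L K H : hopfAlgType k) (j : {hopf K -> H})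
    (f : {hopf L -> H}) :
  injective j -> (forall l, exists x, j x = f l) ->
  exists g : {hopf L -> K}, j \o g =1 f.
Proof.
move=> j_inj /choice[g jg].
have gL : linear g.
  move=> a x y; apply: j_inj; rewrite jg (linearP f) (linearP j).
  exact: esym (congr2 +%R (congr1 _ (jg x)) (jg y)).
have gM : monoid_morphism g.
  split=> [|x y]; apply: j_inj; rewrite jg ?(rmorph1 f) ?(rmorph1 j) //.
  by rewrite (rmorphM f) (rmorphM j); exact: esym (congr2 *%R (jg x) (jg y)).
pose g' : {lrmorphism L -> K} := HB.pack g
  (GRing.isLinear.Build k L K _ g gL) (GRing.isMonoidMorphism.Build L K g gM).
have [r jK] := linear_retraction j_inj.
have gD l : comul (g' l) = tmap g' g' (comul l).
  apply: (tmap_inc_inj (inc := j) jK).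
  have E1 : tmap j j (comul (g' l)) = comul (j (g' l)) by rewrite comul_morph.
  rewrite E1 [j _]jg comul_morph (tmap_comp g' g' j j).
  have fE x : f x = (j \o g') x := esym (jg x).
  exact (tmap_ext (f := f) (f' := j \o g') (g := f) (g' := j \o g') fE fE _).
have ge l : counit (g' l) = counit l.
  have E1 : counit (j (g' l)) = counit (g' l) by rewrite counit_morph.
  by rewrite -E1 [j _]jg counit_morph.
have [h hE] := hopf_of_lrmorphism gD ge.
by exists h => l; rewrite /= hE; exact: jg.
Qed.

(** * Generation of a coproduct by its factors *)

Section CoproductGenerated.
Variables (k : fieldType) (I : Type) (H_ : I -> hopfAlgType k).
Variables (H : hopfAlgType k) (iota : forall i, {hopf H_ i -> H}).

Let G (x : H) := exists i y, iota i y = x.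
Let inc : {lrmorphism generated_alg G -> H} := generated_inc G.

Let incP x : generated G x -> exists u, inc u = x.
Proof. by move/generated_incP. Qed.

Fact generated_comul u : exists t, comul (inc u) = tmap inc inc t.
Proof.
have [r incK] := linear_retraction (@generated_inc_inj k H G).
have: generated G (inc u) by apply/generated_incP; exists u.
elim=> {u} [_ [i [y <-]]||x y _ [s xs] _ [t yt]|a x y _ [s xs] _ [t yt]].
(* The corestriction of [iota i] to the generated subalgebra, where its image lies. *)
- pose g : {linear H_ i -> generated_alg G} := r \o iota i.
  have incg z : iota i z = (inc \o g) z.
    have [u iu] : exists u, inc u = iota i z by apply/incP/GenIn; exists i, z.
    by rewrite /= -iu; congr (inc _); rewrite incK.
  exists (tmap g g (comul y)); rewrite comul_morph tmap_comp.
  exact (tmap_ext (f := iota i) (f' := inc \o g) (g := iota i)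
    (g' := inc \o g) incg incg (comul y)).
- by exists (1 ⊗ 1); rewrite comul1 tmapE rmorph1.
- exists (tens_mul s t); rewrite comulM tmapM.
  exact (congr2 _ xs yt).
- exists (a *: s + t); rewrite tmapP linearP.
  exact (congr2 _ (congr1 _ xs) yt).
Qed.

Fact antipode1 : antipode 1 = 1 :> H.
Proof.
have := antipodel (1 : H); rewrite comul1 tmapE tmulE mulr1 => ->.
by rewrite counit1 scale1r.
Qed.

(** The antipode commutes with each [iota i], so it preserves the generators, and it reverses
    products, so it preserves the subalgebra. *)
Fact generated_antipode u : exists v, antipode (inc u) = inc v.
Proof.
suff: generated G (antipode (inc u)) by case/incP=> v <-; exists v.
have: generated G (inc u) by apply/generated_incP; exists u.
elim=> {u} [_ [i [y <-]]||x y _ gx _ gy|a x y _ gx _ gy].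
- apply: GenIn; exists i, (antipode y); apply: esym.
  exact (antipode_morph comulA counitl antipoder antipodel antipoder
    (f := iota i) (comul_morph (s := iota i)) (counit_morph (s := iota i)) y).
- by rewrite antipode1; exact: Gen1.
- rewrite (antipodeM comulA counitl comulM counitM antipodel antipoder).
  exact: GenM.
- by rewrite linearP; exact: GenLin.
Qed.

(* The inclusion of the Hopf subalgebra generated by the images has a section
   by the universal property. *)
Lemma coproduct_generated :
  is_hopf_coproduct iota -> forall h, generated G h.
Proof.
move=> univ h.
have [K [j [j_inj jP]]] :=
  subalgebra_hopf (@generated_inc_inj k H G) generated_comul generated_antipode.
have lift i : exists g : {hopf H_ i -> K}, j \o g =1 iota i.
  apply: hopf_lift => // y; apply/jP/incP/GenIn; by exists i, y.
have [f fE] : exists f : forall i, {hopf H_ i -> K},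
    forall i, j \o f i =1 iota i.
  pose f i := sval (cid (lift i)); exists f => i; exact: svalP (cid (lift i)).
have [g gf _] := univ K f.
(* The identity and j ∘ g both extend the family [iota], so they agree and [j] is surjective. *)
have [h' _ h'_uniq] := univ H iota.
have idE : idfun =1 h' by apply: h'_uniq.
have jgE : j \o g =1 h'.
  by apply: h'_uniq => i x; rewrite -fE /= -gf.
apply/generated_incP/jP; exists (g h); exact: etrans (jgE h) (esym (idE h)).
Qed.

End CoproductGenerated.

(** * Central maps *)

Section CentralMaps.
Variable k : fieldType.

(* The map p is central when [central_at p (comul h)] holds for all h. *)
Definition central_at (V W : lmodType k) (p : {linear V -> W}) (t : tens V V) :=
  tmap p idfun t = tmap p idfun (tswap t).

Lemma central_at_ext (V W : lmodType k) (p q : {linear V -> W}) t :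
  p =1 q -> central_at p t -> central_at q t.
Proof.
move=> pq ct.
have E s : tmap q idfun s = tmap p idfun s.
  exact (tmap_ext (f := q) (f' := p) (g := idfun) (g' := idfun)
    (fun x => esym (pq x)) (fun=> erefl) s).
by rewrite /central_at !E.
Qed.

Lemma central_at_tmap (V V' W : lmodType k) (p : {linear V -> W})
    (f : {linear V' -> V}) t :
  central_at (p \o f) t -> central_at p (tmap f f t).
Proof.
move=> ct; rewrite /central_at tswap_tmap !(tmap_comp f f p idfun).
transitivity (tmap idfun f (tmap (p \o f) idfun t)); first by rewrite tmap_comp.
by rewrite ct tmap_comp.
Qed.

(** Applying id ⊗ g undoes [f] in the second factor. This is where a retraction of [iota i] is
    needed to restrict central maps. *)
Lemma central_at_tmap_can (V V' W : lmodType k) (p : {linear V -> W})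
    (f : {linear V' -> V}) (g : {linear V -> V'}) t :
  cancel f g -> central_at p (tmap f f t) -> central_at (p \o f) t.
Proof.
move=> fK; rewrite /central_at tswap_tmap => ct.
have E s : tmap (p \o f) idfun s = tmap idfun g (tmap p idfun (tmap f f s)).
  rewrite (tmap_comp f f p idfun) (tmap_comp (p \o f) (idfun \o f) idfun g).
  exact (tmap_ext (f := p \o f) (f' := idfun \o (p \o f)) (g := idfun)
    (g' := g \o (idfun \o f)) (fun=> erefl) (fun x => esym (fK x)) s).
by rewrite !E ct.
Qed.

Lemma central_at_comp (V W W' : lmodType k) (p : {linear V -> W})
    (q : {linear W -> W'}) t :
  central_at p t -> central_at (q \o p) t.
Proof.
have E s : tmap (q \o p) idfun s = tmap q idfun (tmap p idfun s).
  by rewrite tmap_comp.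
by rewrite /central_at !E => ->.
Qed.

Lemma central_atP (V W : lmodType k) (p : {linear V -> W}) a s t :
  central_at p s -> central_at p t -> central_at p (a *: s + t).
Proof.
move=> cs ct; rewrite /central_at tswapP !tmapP.
exact (congr2 _ (congr1 _ cs) ct).
Qed.

Lemma central_atM (A B : algType k) (p : {lrmorphism A -> B}) s t :
  central_at p s -> central_at p t -> central_at p (tens_mul s t).
Proof.
move=> cs ct; rewrite /central_at tswapM.
apply: (etrans (tmapM p idfun s t)).
apply: etrans (esym (tmapM p idfun (tswap s) (tswap t))).
exact (congr2 _ cs ct).
Qed.

(** The two algebra maps whose equality expresses centrality agree on a subalgebra. *)
Lemma central_on_generated (H K : hopfAlgType k) (G : H -> Prop)
    (p : {hopf H -> K}) :
  (forall x, G x -> central_at p (comul x)) ->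
  forall x, generated G x -> central_at p (comul x).
Proof.
move=> cG x; elim=> {x} [x /cG//||x y _ cx _ cy|a x y _ cx _ cy].
- by rewrite comul1 /central_at tswapE.
- rewrite comulM; exact (central_atM cx cy).
- rewrite (linearP comul); exact (central_atP a cx cy).
Qed.

Lemma coproduct_retraction (I : Type) (H_ : I -> hopfAlgType k)
    (H : hopfAlgType k) (iota : forall i, {hopf H_ i -> H}) :
  is_hopf_coproduct iota ->
  forall i, exists g : {hopf H -> H_ i}, cancel (iota i) g.
Proof.
move=> univ i.
have [f fi] : exists f : forall j, {hopf H_ j -> H_ i}, f i =1 id.
  (* Equality on the arbitrary type [I] is decided classically; proof irrelevance then reduces the
     transport at [i] to the identity. *)
  pose f j : {hopf H_ j -> H_ i} := match pselect (j = i) with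
    | left ji => let: erefl := ji in idfun : {hopf H_ j -> H_ j}
    | right _ => @trivial_map k (H_ j) (H_ i)
    end.
  exists f; rewrite /f; case: pselect => // e.
  by rewrite (Prop_irrelevance e erefl).
have [g gf _] := univ (H_ i) f.
by exists g => x; rewrite -[RHS]fi -gf.
Qed.

End CentralMaps.

(** * Universal grading groups of coproducts *)

Theorem theorem4p1 (k : closedFieldType) (I : Type)
    (H_ : I -> hopfAlgType k) (H : hopfAlgType k)
    (iota : forall i : I, {hopf H_ i -> H})
    (cosemisimpleH_ : forall i : I, cosemisimple (H_ i))
    (coproductH : is_hopf_coproduct iota)
    (Z_ : forall i : I, central_arrow (H_ i)) (Z : central_arrow H)
    (centerZ_ : forall i : I, is_center (Z_ i)) (centerZ : is_center Z) :
  exists phi : forall i : I, {multiplicative ca_group (Z_ i) -> ca_group Z},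
    [/\ forall i : I, induces (iota i) (phi i),
        forall (i : I) (psi : {multiplicative ca_group (Z_ i) -> ca_group Z}),
          induces (iota i) psi -> psi =1 phi i &
        is_group_coproduct phi].
Proof.
(* Initiality of a center, restated with group homomorphisms in place of Hopf maps between group
   algebras. *)
have center_ind (L : hopfAlgType k) (C A : central_arrow L) : is_center C ->
  exists2 phi : {multiplicative ca_group C -> ca_group A},
    (forall h, galg_map phi (ca_map C h) = ca_map A h) &
    forall psi : {multiplicative ca_group C -> ca_group A},
      (forall h, galg_map psi (ca_map C h) = ca_map A h) -> psi =1 phi.
  move=> cC; have [f fT f_uniq] := cC A; have [phi fphi] := hopf_galg_map f.
  exists phi => [h|psi psiT]; first exact: etrans (esym (fphi _)) (fT h).
  apply: (@galg_map_inj k) => x.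
  exact: etrans (f_uniq (galg_map psi) psiT x) (fphi x).
have restr_central i : central (ca_map Z \o iota i).
  move=> h; have [g iotaK] := coproduct_retraction coproductH i.
  apply: (central_at_tmap_can (p := ca_map Z) iotaK).
  have := ca_central Z (iota i h); rewrite comul_morph; exact.
pose R i := CentralArrow (restr_central i).
have phi_ex i : exists phi : {multiplicative ca_group (Z_ i) -> ca_group Z},
    induces (iota i) phi /\ forall psi, induces (iota i) psi -> psi =1 phi.
  have [phi phiT phi_uniq] := center_ind _ (Z_ i) (R i) (centerZ_ i).
  by exists phi.
pose phi i := sval (cid (phi_ex i)).
have phiP i := svalP (cid (phi_ex i)).
exists phi; split=> [i|i psi|K f]; first exact: (phiP i).1.
  exact: (phiP i).2.
(* The family [f] becomes a family of central maps; their common extension [p] to H is central,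
   hence classified by some [g]. *)
pose F i : {hopf H_ i -> galg k K} := galg_map (f i) \o ca_map (Z_ i).
have F_central i : central (F i).
  by move=> h; apply: central_at_comp; exact: ca_central.
have [p pF p_uniq] := coproductH (galg k K) F.
have p_central : central p.
  pose G x := exists i y, iota i y = x.
  move=> h; apply: (central_on_generated (G := G)).
    move=> x [i [y <-]]; rewrite comul_morph; apply: central_at_tmap.
    exact: central_at_ext (fun y' => esym (pF i y')) (F_central i y).
  exact: coproduct_generated.
have [g gT g_uniq] := center_ind _ Z (CentralArrow p_central) centerZ.
exists g => [i a|g' g'f a].
  (* Both [f i] and g ∘ phi i classify the central map [F i], so they coincide. *)
  have [u _ u_uniq] :=
    center_ind _ (Z_ i) (CentralArrow (F_central i)) (centerZ_ i).
  rewrite (u_uniq (f i)) // (u_uniq (g \o phi i)) // => h.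
  apply: (etrans (galg_map_comp g (phi i) (ca_map (Z_ i) h))).
  rewrite (phiP i).1; exact: etrans (gT (iota i h)) (pF i h).
apply: g_uniq => h.
(* The central map classified by [g'] restricts to [F i] on each factor, so it is [p]. *)
apply: (p_uniq (galg_map g' \o ca_map Z)) => i x.
transitivity (galg_map g' (galg_map (phi i) (ca_map (Z_ i) x))).
  by rewrite (phiP i).1.
apply: (etrans (esym (galg_map_comp g' (phi i) (ca_map (Z_ i) x)))).
exact: galg_map_ext (g'f i) _.
Qed.
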